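(* For all positive integers $r,k$ there is a positive integer $n=n(r,k)$ such that for every $r$-coloring of the edges of the complete graph on the vertex set $[n]=\{1,\ldots,n\}$ there exist natural numbers $a,d_1,\ldots,d_k$ such that the Hilbert cube $H=H(a;d_1,\ldots,d_k)$ is contained in $[n]$, its $2^k$ elements $a+\sum_{i\in I}d_i$ ($I\subseteq[k]$) are pairwise distinct, and all edges of the complete graph between elements of $H$ have the same color.
   Context: For natural numbers $a,d_1,\ldots,d_k$, the Hilbert cube of dimension $k$ is $H(a;d_1,\ldots,d_k)=\{a+\sum_{i\in I}d_i : I\subseteq\{1,\ldots,k\}\}$. An $r$-coloring of a set $X$ is a map $X\to\{1,\ldots,r\}$. *)

(* Defs.v *)
From mathcomp Require Import all_boot finmap.

Set Implicit Arguments.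
Unset Strict Implicit.
Unset Printing Implicit Defensive.

Local Open Scope fset_scope.

Definition interval1 (n : nat) : {fset nat} := [fset x | x in iota 1 n].

Lemma in_interval1 (n x : nat) : (x \in interval1 n) = (1 <= x <= n).
Proof. by rewrite !inE mem_iota add1n ltnS. Qed.

(* Edges of the complete graph on [n] : two-element subsets of {1, ..., n}. *)
Definition complete_edge (n : nat) : Type :=
  {e : {fset nat} | (e `<=` interval1 n) && (#|` e| == 2)}.

Definition edge_set (n : nat) (e : complete_edge n) : {fset nat} := sval e.

(* Colors 1, ..., r are represented by the r elements of 'I_r. *)
Definition edge_coloring (r n : nat) : Type := complete_edge n -> 'I_r.

Definition cube_point (k a : nat) (d : 'I_k -> nat) (I : {set 'I_k}) : nat :=
  (a + \sum_(i in I) d i)%N.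

Definition hilbert_cube (k a : nat) (d : 'I_k -> nat) : {fset nat} :=
  [fset cube_point a d I | I in [set: {set 'I_k}]].

Lemma in_hilbert_cube (k a : nat) (d : 'I_k -> nat) (x : nat) :
  reflect (exists I : {set 'I_k}, x = (a + \sum_(i in I) d i)%N)
          (x \in hilbert_cube a d).
Proof.
apply: (iffP idP) => [/imfsetP[I _ ->]|[I ->]]; first by exists I.
by apply/imfsetP; exists I => //=; rewrite inE.
Qed.

Definition monochromatic (r n : nat) (c : edge_coloring r n) (H : {fset nat}) : Prop :=
  exists j : 'I_r,
    forall e : complete_edge n, edge_set e `<=` H -> c e = j.

(* Main.v *)
Require Import Defs.
From mathcomp Require Import all_boot finmap.
From mathcomp Require Import zify.

Set Implicit Arguments.
Unset Strict Implicit.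
Unset Printing Implicit Defensive.

(** The Hales-Jewett theorem gives Gallai's theorem on homothetic copies of
    [{0..n}^m]. Cut an initial segment of [nat] into [m] blocks and colour a
    tuple with one point per block by the colours of all the pairs it spans. A
    monochromatic homothetic copy yields one progression per block, all with the
    same step, such that any two of them span a monochromatic bipartite graph.
    If [m] exceeds the number of colourings of the pairs of a progression, two of
    them, [P] and [P + d], are also coloured alike inside. Taking [d] as the
    largest side and recursing inside [P] produces a cube in which the colour of
    an edge only depends on the largest side its two ends differ in. A pigeonhole
    on these sides finishes the proof. *)

(** * The Hales-Jewett theorem *)

Section HalesJewett.
Variable T : finType.
Implicit Types (t a : T) (A : seq T) (l : seq (option T)).

(* A combinatorial line is a word over [option T] in which the variable, written
   [None], occurs. *)
Definition line_eval t l : seq T := [seq odflt t o | o <- l].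

Lemma line_eval_cat t l1 l2 :
  line_eval t (l1 ++ l2) = line_eval t l1 ++ line_eval t l2.
Proof. by rewrite /line_eval map_cat. Qed.

Lemma line_eval_const t (w : seq T) : line_eval t (map Some w) = w.
Proof. by rewrite /line_eval -map_comp map_id_in. Qed.

Lemma size_line_eval t l : size (line_eval t l) = size l.
Proof. by rewrite size_map. Qed.

(** Only letters of [A] are compared, so that Hales-Jewett can go by induction on [A] while the
    alphabet [T] stays fixed. *)
Definition mono_line (C : Type) (f : seq T -> C) A N l :=
  [/\ size l = N, None \in l
    & {in A &, forall t t', f (line_eval t l) = f (line_eval t' l)}].

Definition focused_lines (C : eqType) (f : seq T -> C) t0 A a N ls w :=
  [/\ size w = N, forall l, l \in ls -> mono_line f (t0 :: A) N l,
      forall l, l \in ls -> line_eval a l = w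
    & uniq [seq f (line_eval t0 l) | l <- ls]].

Lemma mono_line_cons (C : Type) (f : seq T -> C) t0 A a N l :
  mono_line f (t0 :: A) N l -> f (line_eval a l) = f (line_eval t0 l) ->
  mono_line f (a :: t0 :: A) N l.
Proof.
move=> [sl Nl ml] fa; split=> //.
have key t : t \in a :: t0 :: A -> f (line_eval t l) = f (line_eval t0 l).
  by rewrite inE => /predU1P[-> //|tA]; apply: ml => //; rewrite mem_head.
by move=> t t' /key -> /key ->.
Qed.

(** Colour focusing, by induction on [s]. The colour of the focus [w] either repeats that of a
    focused line, which then extends to the letter [a], or is new and lets the family grow by one
    line. *)
Lemma focusing_step t0 A a :
  (forall C : finType, exists N, forall f : seq T -> C,
     exists l, mono_line f (t0 :: A) N l) ->
  forall (C : finType) s, exists N, forall f : seq T -> C,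
    (exists l, mono_line f (a :: t0 :: A) N l) \/
    (exists ls w, size ls = s /\ focused_lines f t0 A a N ls w).
Proof.
move=> HJ C; elim=> [|s [N1 IHs]].
  by exists 0 => f; right; exists [::], [::].
(* A prefix is coloured by the whole colouring it induces on suffixes of length [N1]. Along a line
   [L] for this colouring, the letters of [t0 :: A] are interchangeable in front of any suffix. *)
have [N2 HN2] := HJ {ffun N1.-tuple T -> C}.
exists (N2 + N1) => f.
have [L [sL NL mL]] := HN2 (fun v => [ffun w : N1.-tuple T => f (v ++ w)]).
pose h w := f (line_eval t0 L ++ w).
have hE t w : t \in t0 :: A -> size w = N1 -> f (line_eval t L ++ w) = h w.
  move=> tA /eqP sw.
  by have := mL t t0 tA (mem_head _ _) => /ffunP/(_ (Tuple sw)); rewrite !ffunE.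
have lift l : mono_line h (a :: t0 :: A) N1 l ->
    exists l', mono_line f (a :: t0 :: A) (N2 + N1) l'.
  move=> [sl Nl ml]; exists (map Some (line_eval t0 L) ++ l); split.
  - by rewrite size_cat size_map size_line_eval sL sl.
  - by rewrite mem_cat Nl orbT.
  - by move=> t t' tA tA'; rewrite !line_eval_cat !line_eval_const; apply: ml.
case: (IHs h) => [[l /lift]|[ls [w [sls [sw mls fls uls]]]]]; first by left.
have [/mapP[l lls hw]|hw] :=
  boolP (h w \in [seq h (line_eval t0 l) | l <- ls]).
  left; apply: (lift l); apply: mono_line_cons; first exact: mls.
  by rewrite fls.
(* The old lines keep their colours under the prefix [L]. The new line, constant on the suffix, has
   the colour [h w], and all of them meet at the letter [a]. *)
right; exists ((L ++ map Some w) :: [seq L ++ l | l <- ls]), (line_eval a L ++ w).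
split; first by rewrite /= size_map sls.
split.
- by rewrite size_cat size_line_eval sL sw.
- move=> l; rewrite inE => /predU1P[->|/mapP[l' l'ls ->]].
    split; first by rewrite size_cat size_map sL sw.
    + by rewrite mem_cat NL.
    + by move=> t t' tA tA'; rewrite !line_eval_cat !line_eval_const !hE.
  have [sl' Nl' ml'] := mls _ l'ls.
  split; first by rewrite size_cat sL sl'.
  + by rewrite mem_cat NL.
  + move=> t t' tA tA'; rewrite !line_eval_cat !hE ?size_line_eval //.
    exact: ml'.
- move=> l; rewrite inE => /predU1P[->|/mapP[l' l'ls ->]].
    by rewrite line_eval_cat line_eval_const.
  by rewrite line_eval_cat (fls _ l'ls).
- rewrite /= line_eval_cat line_eval_const -/(h w) -map_comp.
  rewrite (@eq_map _ _ _ (fun l => h (line_eval t0 l))) ?hw //.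
  by move=> l /=; rewrite line_eval_cat.
Qed.

Theorem Hales_Jewett A (C : finType) :
  exists N, forall f : seq T -> C, exists l, mono_line f A N l.
Proof.
elim: A C => [|a A IHA] C; first by exists 1 => f; exists [:: None].
case: A IHA => [_|t0 A IHA].
  exists 1 => f; exists [:: None]; split=> // t t'.
  by rewrite !inE => /eqP-> /eqP->.
(* More than [#|C|] focused lines would need too many distinct colours. *)
have [N HN] := focusing_step a IHA C #|C|.+1.
exists N => f; case: (HN f) => // -[ls [w [sls [_ _ _ uls]]]].
have := max_card (mem [seq f (line_eval t0 l) | l <- ls]).
by rewrite (card_uniqP uls) size_map sls ltnn.
Qed.

End HalesJewett.

(** * Gallai's theorem *)

Theorem Gallai (m n : nat) (C : finType) :
  exists B, forall f : {ffun 'I_m -> nat} -> C,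
    exists (u : 'I_m -> nat) (x : nat),
      [/\ 0 < x, forall i, u i + x * n <= B
        & forall v v' : 'I_m -> 'I_n.+1,
            f [ffun i => u i + x * v i] = f [ffun i => u i + x * v' i]].
Proof.
(* Letters are the vectors of the grid, and a word is sent to the sum of its letters. A line then
   becomes a homothetic copy: its constant letters add up to [u], and [x] counts its variables. *)
pose T := {ffun 'I_m -> 'I_n.+1}.
have [N HN] := Hales_Jewett (enum T) C.
exists (N * n) => f.
have [l [sl Nl ml]] := HN (fun w => f [ffun i => \sum_(t <- w) (t : T) i]).
pose u i := \sum_(o <- l) oapp (fun t : T => t i : nat) 0 o.
pose x := count_mem None l.
have sumE (t : T) i : \sum_(s <- line_eval t l) (s i : nat) = u i + x * t i.
  rewrite /u /x /line_eval; elim: (l) => [|o l' IH]; first by rewrite !big_nil.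
  by rewrite /= !big_cons IH; case: o => [s|] /=; lia.
exists u, x; split.
- by rewrite -has_count; apply/hasP; exists None.
- move=> i; have := sumE [ffun=> ord_max] i; rewrite ffunE /= => <-.
  rewrite -sl -(size_line_eval [ffun=> ord_max] l).
  elim: (line_eval _ _) => [|s w IH]; first by rewrite big_nil.
  by rewrite big_cons /= mulSn leq_add // -ltnS ltn_ord.
- move=> v v'.
  have := ml (finfun v) (finfun v'); rewrite !mem_enum => /(_ isT isT).
  have fE (z : 'I_m -> 'I_n.+1) :
      [ffun i => \sum_(t <- line_eval (finfun z) l) (t : T) i : nat] =
      [ffun i => u i + x * z i].
    by apply/ffunP => i; rewrite !ffunE sumE ffunE.
  by rewrite !fE.
Qed.

(** * Cubes coloured by their largest differing side *)

Lemma twin_progressions (n : nat) (C : finType) :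
  exists W, forall c : nat -> nat -> C, exists a x d (g : C),
    [/\ 0 < x, a + x * n < a + d, a + d + x * n <= W,
        forall s t, s <= n -> t <= n -> c (a + x * s) (a + d + x * t) = g
      & forall s t, s <= n -> t <= n ->
          c (a + d + x * s) (a + d + x * t) = c (a + x * s) (a + x * t)].
Proof.
pose m := #|{ffun 'I_n.+1 * 'I_n.+1 -> C}|.+1.
have [B HB] := Gallai m n {ffun 'I_m * 'I_m -> C}.
(* Blocks have length [B.+1] because Gallai's theorem places every coordinate in [[0, B]]. *)
exists (m * B.+1) => c.
pose f (p : {ffun 'I_m -> nat}) :=
  [ffun ij : 'I_m * 'I_m => c (ij.1 * B.+1 + p ij.1) (ij.2 * B.+1 + p ij.2)].
have [u [x [x0 ub fE]]] := HB f.
pose q (i : 'I_m) := i * B.+1 + u i.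
pose pat (i : 'I_m) :=
  [ffun st : 'I_n.+1 * 'I_n.+1 => c (q i + x * st.1) (q i + x * st.2)].
have [i [j [ltij pat_ij]]] : exists i j : 'I_m, i < j /\ pat i = pat j.
  have /injectivePn[i [j nij pij]] : ~~ injectiveb pat.
    apply/negP => /injectiveP/leq_card.
    by rewrite card_ord ltnn.
  case: (ltngtP i j) => [lt|lt|/val_inj E]; last by rewrite E eqxx in nij.
    by exists i, j.
  by exists j, i.
have ui := ub i; have uj := ub j; have jm := ltn_ord j.
have lt_q : q i + x * n < q j by rewrite /q; nia.
have qE : q i + (q j - q i) = q j by lia.
exists (q i), x, (q j - q i), (f [ffun k => u k + x * (ord0 : 'I_n.+1)] (i, j)).
rewrite qE; split=> //.
- by rewrite /q; nia.
- move=> s t sn tn.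
  (* Since [i] and [j] are different coordinates, one grid vector realises [s] and [t]
     independently. *)
  rewrite -(fE (fun k => if k == i then inord s else inord t)) !ffunE /=.
  have /negPf -> : j != i by apply/eqP => E; rewrite E ltnn in ltij.
  by rewrite eqxx !inordK // !addnA.
- move=> s t sn tn.
  have := congr1 (fun p : {ffun _ -> _} => p (inord s, inord t)) pat_ij.
  by rewrite !ffunE /= !inordK.
Qed.

(** Sides and bits are indexed by [nat], so that the recursion on [K] needs no casts between
    ordinals. *)
Definition bit_point (K a : nat) (d : nat -> nat) (b : nat -> bool) : nat :=
  a + \sum_(i < K) b i * d i.

Lemma bit_point_le K a d b : bit_point K a d b <= a + \sum_(i < K) d i.
Proof. by rewrite leq_add2l leq_sum // => i _; case: (b i); lia. Qed.

Lemma leading_side_cube (K : nat) (C : finType) :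
  exists W, forall c : nat -> nat -> C, exists a (d : nat -> nat) (g : nat -> C),
    a + \sum_(i < K) d i <= W /\
    forall (b b' : nat -> bool) i, i < K -> ~~ b i -> b' i ->
      (forall j, i < j -> j < K -> b j = b' j) ->
      bit_point K a d b < bit_point K a d b' /\
      c (bit_point K a d b) (bit_point K a d b') = g i.
Proof.
elim: K => [|K [W' IH]].
  exists 0 => c; exists 0, (fun=> 0), (fun=> c 0 0).
  by rewrite big_ord0.
have [W HW] := twin_progressions W' C.
exists W => c.
have [a [x [d [g [x0 ltd dW cross same]]]]] := HW c.
(* The smaller cube is found in the indices of the first progression. The twin progression repeats
   its colours, and pairs across the two have the colour [g]. *)
have [a' [d' [g' [aW Hd']]]] := IH (fun s t => c (a + x * s) (a + x * t)).
pose D i := if i < K then x * d' i else d.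
exists (a + x * a'), D, (fun i => if i < K then g' i else g).
have sumD (e : nat -> nat) :
    \sum_(i < K.+1) e i * D i = x * (\sum_(i < K) e i * d' i) + e K * d.
  rewrite big_ord_recr /= {2}/D ltnn big_distrr /=; congr (_ + _).
  by apply: eq_bigr => i _; rewrite /D ltn_ord; lia.
have sum1 (h : nat -> nat) k : \sum_(i < k) h i = \sum_(i < k) 1 * h i.
  by apply: eq_bigr => i _; rewrite mul1n.
split.
  by rewrite sum1 (sumD (fun=> 1)) -sum1; nia.
have pE b : bit_point K.+1 (a + x * a') D b =
    a + b K * d + x * bit_point K a' d' b.
  by rewrite /bit_point (sumD (fun i => b i)); nia.
have pW b : bit_point K a' d' b <= W'.
  exact: leq_trans (bit_point_le _ _ _ _) aW.
move=> b b' i iK nbi bi' agree; rewrite !pE.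
move: iK; rewrite ltnS leq_eqVlt => /predU1P[iK|iK].
  subst i; rewrite ltnn (negPf nbi) bi' mul0n mul1n addn0; split.
    by have := pW b; nia.
  exact: cross.
have [lt_p cE] := Hd' b b' i iK nbi bi' (fun j ij jK => agree j ij (ltnW jK)).
rewrite iK -(agree K iK (ltnSn K)); split; first by nia.
by case: (b K); rewrite ?mul1n ?mul0n ?addn0 ?same // cE.
Qed.

(** * Pigeonhole on the sides *)

Lemma large_fiber (r k : nat) (g : 'I_(r * k) -> 'I_r) :
  0 < r -> 0 < k -> exists j, k <= #|[set i | g i == j]|.
Proof.
move=> r0 k0; apply/existsP; rewrite -[[exists _, _]]negbK negb_exists; apply/negP => /forallP lt.
have : \sum_(j < r) #|[set i | g i == j]| <= \sum_(j < r) k.-1.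
  by apply: leq_sum => j _; have := lt j; lia.
have -> : \sum_(j < r) #|[set i | g i == j]| = r * k.
  rewrite -[RHS]card_ord -sum1_card (partition_big g xpredT) //=.
  by apply: eq_bigr => j _; rewrite -sum1_card; apply: eq_bigl => i; rewrite inE.
by rewrite sum_nat_const card_ord; nia.
Qed.

Lemma last_difference (K : nat) (A B : {set 'I_K}) :
  A != B -> exists i : 'I_K,
    (i \in A) != (i \in B) /\
    forall j : 'I_K, i < j -> (j \in A) = (j \in B).
Proof.
move=> nAB.
have [i0 Hi0] : exists i, (i \in A) != (i \in B).
  apply/existsP; rewrite -[[exists _, _]]negbK negb_exists; apply: contra nAB => /forallP H.
  by apply/eqP/setP => i; apply/eqP; have := H i; rewrite negbK.
case: (@arg_maxnP _ i0 (fun i => (i \in A) != (i \in B)) val Hi0) => i Hi imax.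
exists i; split=> // j ij; apply/eqP/negPn/negP => /imax.
by rewrite /geq /= leqNgt ij.
Qed.

Theorem ordered_pairs_cube (r k : nat) : 0 < r -> 0 < k ->
  exists W, forall c : nat -> nat -> 'I_r,
    exists a (d : 'I_k -> nat) (g : 'I_r),
      [/\ forall I, cube_point a d I <= W,
          injective (cube_point a d)
        & forall I J, cube_point a d I < cube_point a d J ->
            c (cube_point a d I) (cube_point a d J) = g].
Proof.
move=> r0 k0; pose K := r * k.
have [W HW] := leading_side_cube K 'I_r.
exists W => c; have [a [d [g [aW Hd]]]] := HW c.
have [j0 Hj0] := large_fiber (fun i => g i) r0 k0.
pose e (i : 'I_k) : 'I_K := enum_val (widen_ord Hj0 i).
have e_inj : injective e.
  by move=> i i' /enum_val_inj/(congr1 val) /= /val_inj.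
have ge i : g (e i) = j0 by have := enum_valP (widen_ord Hj0 i); rewrite inE => /eqP.
(* A vertex of the subcube is viewed in the large cube with every unselected side switched off. *)
pose bits (I : {set 'I_k}) j := [exists i in I, e i == j :> nat].
have bitsE (I : {set 'I_k}) (j : 'I_K) : bits I j = (j \in e @: I).
  apply/exists_inP/imsetP => [[i iI /eqP/val_inj E]|[i iI ->]]; exists i => //.
have pE I : cube_point a (d \o e) I = bit_point K a d (bits I).
  rewrite /bit_point /cube_point; congr (_ + _).
  rewrite -(big_imset (fun j : 'I_K => d j)) /=; last by move=> ? ? _ _ /e_inj.
  rewrite big_mkcond /=; apply: eq_bigr => j _.
  by rewrite bitsE; case: (_ \in _); rewrite ?mul1n ?mul0n.
have key I J : I != J ->
    let p := cube_point a (d \o e) I in let q := cube_point a (d \o e) J in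
    (p < q /\ c p q = j0) \/ (q < p /\ c q p = j0).
  move=> nIJ p q; rewrite /p /q !pE.
  have [i [di agree]] : exists i : 'I_K,
      (i \in e @: I) != (i \in e @: J) /\
      forall j : 'I_K, i < j -> (j \in e @: I) = (j \in e @: J).
    by apply: last_difference; apply: contra_neq nIJ; apply: imset_inj.
  (* The last difference lies in the image of [e], so it is a selected side. *)
  have gi : g i = j0.
    have /imsetP[z _ ->] : i \in e @: (I :|: J).
      by rewrite imsetU inE; move: di; do 2 case: (i \in _).
    exact: ge.
  have agree' j : i < j -> j < K -> bits I j = bits J j.
    by move=> ij jK; rewrite (bitsE I (Ordinal jK)) (bitsE J (Ordinal jK)) agree.
  rewrite -gi; case: (boolP (i \in e @: I)) di => bI;
    case: (boolP (i \in e @: J)) => // bJ _.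
    right; apply: Hd; rewrite ?bitsE // => j ij jK.
    by rewrite agree'.
  by left; apply: Hd; rewrite ?bitsE.
exists a, (d \o e), j0; split.
- by move=> I; rewrite pE; apply: leq_trans (bit_point_le _ _ _ _) aW.
- move=> I J E; apply/eqP/negPn/negP => /key /=.
  by rewrite E ltnn => -[] [].
- move=> I J lt; have nIJ : I != J by apply: contraTneq lt => ->; rewrite ltnn.
  by case: (key _ _ nIJ) => -[] //; rewrite ltnNge (ltnW lt).
Qed.

(** * From ordered pairs to edges of the complete graph *)

Local Open Scope fset_scope.

Lemma cardfs2_ex (K : choiceType) (A : {fset K}) :
  #|` A| = 2 -> exists x y, x != y /\ A = [fset x; y].
Proof.
move=> A2; have /fset0Pn[x xA] : A != fset0 by rewrite -cardfs_gt0 A2.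
move: A2; rewrite (cardfsD1 x) xA => -[] /eqP/cardfs1P[y Ay].
have : y \in A `\ x by rewrite Ay inE.
rewrite !inE => /andP[nyx _]; exists x, y; split; first by rewrite eq_sym.
by rewrite -(fsetD1K xA) Ay.
Qed.

Theorem theorem1 (r k : nat) (hr : 0 < r) (hk : 0 < k) :
  exists n : nat, 0 < n /\
    forall c : edge_coloring r n,
      exists (a : nat) (d : 'I_k -> nat),
        [/\ hilbert_cube a d `<=` interval1 n,
            injective (cube_point a d)
          & monochromatic c (hilbert_cube a d)].
Proof.
have [W HW] := ordered_pairs_cube hr hk.
exists W.+1; split=> // c.
(* The shift by one moves [{0..W}] onto the vertices [{1..W.+1}]. Pairs that are not edges, such as
   those with [x = y], get a default colour. *)
pose col (x y : nat) : 'I_r := oapp c (Ordinal hr) (insub [fset x.+1; y.+1]).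
have [a [d [g [leW inj_p mono]]]] := HW col.
have pS I : cube_point a.+1 d I = (cube_point a d I).+1 by [].
exists a.+1, d; split.
- apply/fsubsetP => x /in_hilbert_cube[I ->].
  by rewrite in_interval1; apply: leW.
- by move=> I J; rewrite !pS => -[] /inj_p.
- exists g => E EH.
  have colE I J : edge_set E = [fset cube_point a.+1 d I; cube_point a.+1 d J] ->
      c E = col (cube_point a d I) (cube_point a d J).
    by rewrite /col -!pS => <-; rewrite /edge_set valK.
  have /andP[_ /eqP/cardfs2_ex[x [y [nxy Exy]]]] := valP E.
  have /in_hilbert_cube[I xI] : x \in hilbert_cube a.+1 d.
    by apply: (fsubsetP EH); rewrite /edge_set Exy !inE eqxx.
  have /in_hilbert_cube[J yJ] : y \in hilbert_cube a.+1 d.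
    by apply: (fsubsetP EH); rewrite /edge_set Exy !inE eqxx orbT.
  rewrite -!/(cube_point _ _ _) in xI yJ; subst x y.
  (* An edge is unordered, so its ends may be listed with the smaller first, as [mono] requires. *)
  case: (ltngtP (cube_point a d I) (cube_point a d J)) => lt.
  + by rewrite (colE I J) // mono.
  + by rewrite (colE J I) ?mono // /edge_set Exy fsetUC.
  + by rewrite !pS lt eqxx in nxy.
Qed.
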